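(* Let $\beta=\beta^1\beta^2\in\mathrm{Br}_k^+$ be a positive braid word of length $r$, where $\beta^1$ has length $r_1$. With the maps defined in the context, the following two diagrams commute, i.e.: (i) $\varphi_1$ restricts to a map from $\mathcal{U}_{r_1}\subseteq\mathrm{BS}(\beta)$ to $\mathcal{U}_{r_1,e}\subseteq X(\beta\Delta)$, and $$\Phi_{r_1,e}\circ\varphi_1=(\varphi_2\times\varphi_1)\circ\Phi_{r_1}:\ \mathcal{U}_{r_1}\to X(\Delta\beta^1)\times X(\beta^2\Delta),$$ where $\Phi_{r_1,e}$ is taken for the factorization $\beta\Delta=\beta^1\cdot(\beta^2\Delta)$; (ii) $\varphi_2$ restricts to a map from $\mathcal{U}_{r_1}\subseteq\mathrm{BS}(\beta)$ to $\mathcal{U}_{r_1+\ell(w_0),w_0}\subseteq X(\Delta\beta)$, and $$\Phi_{r_1+\ell(w_0),w_0}\circ\varphi_2=(\varphi_2\times\varphi_1)\circ\Phi_{r_1}:\ \mathcal{U}_{r_1}\to X(\Delta\beta^1)\times X(\beta^2\Delta),$$ where $\Phi_{r_1+\ell(w_0),w_0}$ is taken for the factorization $\Delta\beta=(\Delta\beta^1)\cdot\beta^2$.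
   Context: **Flags.** $S_k$ is the symmetric group with simple transpositions $s_i$, length $\ell$ and longest element $w_0$; permutations $w$ are identified with permutation matrices $e_i\mapsto e_{w(i)}$. $\mathrm{Br}_k^+$ is the positive braid monoid with generators $\sigma_1,\dots,\sigma_{k-1}$; $\underline{u}$ is the minimal-length positive lift of $u\in S_k$; $\Delta=\underline{w_0}=\sigma_{a_1}\cdots\sigma_{a_{\ell(w_0)}}$ with a fixed reduced word. For $M\in\mathrm{GL}(k)$, $\mathcal{F}(M)$ is the flag whose $j$-th subspace is spanned by the first $j$ columns of $M$; $\mathrm{GL}(k)$ acts by $g\mathcal{F}(M)=\mathcal{F}(gM)$ and on tuples of flags entrywise. $\mathcal{F}^{\mathrm{std}}=\mathcal{F}(e)$, $\mathcal{F}^{\mathrm{ant}}=\mathcal{F}(w_0)$. $\mathcal{F}\xrightarrow{w}\mathcal{F}'$ means that some $g\in\mathrm{GL}(k)$ satisfies $g\mathcal{F}=\mathcal{F}^{\mathrm{std}}$, $g\mathcal{F}'=\mathcal{F}(w)$; $\pitchfork$ means relative position $w_0$. If $\mathcal{F}\xrightarrow{w}\mathcal{F}'$ and $w=s_{b_1}\cdots s_{b_m}$ is reduced, there is a unique chain $\mathcal{F}\xrightarrow{s_{b_1}}\cdots\xrightarrow{s_{b_m}}\mathcal{F}'$. **Varieties.** For $\gamma=\sigma_{i_1}\cdots\sigma_{i_n}$: $X(\gamma)$ is the variety of tuples $(\mathcal{F}^0,\dots,\mathcal{F}^n)$ with $\mathcal{F}^0=\mathcal{F}^{\mathrm{std}}$,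 $\mathcal{F}^n=\mathcal{F}^{\mathrm{ant}}$, $\mathcal{F}^{j-1}\xrightarrow{s_{i_j}}\mathcal{F}^j$; $\mathrm{BS}(\gamma)$ is defined in the same way with $\mathcal{F}^n=\mathcal{F}^{\mathrm{ant}}$ replaced by $\mathcal{F}^n\pitchfork\mathcal{F}^{\mathrm{ant}}$. **Isomorphisms $\varphi_1,\varphi_2$.** $\varphi_1:\mathrm{BS}(\gamma)\to X(\gamma\Delta)$ appends to $(\mathcal{F}^0,\dots,\mathcal{F}^n)$ the unique chain from $\mathcal{F}^n$ to $\mathcal{F}^{\mathrm{ant}}$ with relative positions given by the word $\Delta$. $\varphi_2:\mathrm{BS}(\gamma)\to X(\Delta\gamma)$ is defined as follows: write $\mathcal{F}^n=\mathcal{F}(L')$ with $L'$ lower unitriangular (unique); then $\varphi_2(\mathcal{F}^0,\dots,\mathcal{F}^n)$ is the tuple $w_0(L')^{-1}(\mathcal{F}^0,\dots,\mathcal{F}^n)$ preceded by the unique chain from $\mathcal{F}^{\mathrm{std}}$ to $w_0(L')^{-1}\mathcal{F}^0$ with relative positions given by the word $\Delta$. **Splicing of $\mathrm{BS}$.** $\mathcal{U}_{r_1}=\{(\mathcal{F}^j)\in\mathrm{BS}(\beta)\mid\mathcal{F}^{r_1}\pitchfork\mathcal{F}^{\mathrm{ant}}\}$, and $\Phi_{r_1}:\mathcal{U}_{r_1}\to\mathrm{BS}(\beta^1)\times\mathrm{BS}(\beta^2)$ is $\Phi_{r_1}(\mathcal{F}^0,\dots,\mathcal{F}^r)=\big((\mathcal{F}^0,\dots,\mathcal{F}^{r_1}),L_1^{-1}(\mathcal{F}^{r_1},\dots,\mathcal{F}^r)\big)$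 where $L_1$ is the unique lower unitriangular matrix with $\mathcal{F}^{r_1}=\mathcal{F}(L_1)$. **Splicing of braid varieties.** Let $\gamma=\gamma^1\gamma^2$ be a braid word of length $n$ with $\gamma^1$ of length $n_1$, and $w\in S_k$. Put $\mathcal{U}_{n_1,w}=\{(\mathcal{F}^j)\in X(\gamma)\mid\mathcal{F}^{n_1}\pitchfork\mathcal{F}(w_0w)\}$. Fix a reduced word $w_0=s_{a_1}\cdots s_{a_{\ell(w_0)}}$ with $w=s_{a_1}\cdots s_{a_{\ell(w)}}$ (for $w=e$ or $w=w_0$ use the fixed word of $\Delta$), and let $\widetilde{\mathcal{F}}^j=\mathcal{F}(w_0s_{a_1}\cdots s_{a_j})$, so $\widetilde{\mathcal{F}}^0=\mathcal{F}^{\mathrm{ant}}$, $\widetilde{\mathcal{F}}^{\ell(w)}=\mathcal{F}(w_0w)$, $\widetilde{\mathcal{F}}^{\ell(w_0)}=\mathcal{F}^{\mathrm{std}}$. For a point of $\mathcal{U}_{n_1,w}$ let $L$ be the unique lower unitriangular matrix with $\mathcal{F}^{n_1}=\mathcal{F}(w_0ww_0L)$, and put $g_2=(w_0ww_0L)^{-1}$, $g_1=w_0g_2$. Then $\Phi_{n_1,w}=(\Phi^1,\Phi^2):\mathcal{U}_{n_1,w}\to X(\underline{w^{-1}w_0}\,\gamma^1)\times X(\gamma^2\underline{w})$ is $$\Phi^1=g_1(\widetilde{\mathcal{F}}^{\ell(w)},\dots,\widetilde{\mathcal{F}}^{\ell(w_0)}=\mathcal{F}^0,\mathcal{F}^1,\dots,\mathcal{F}^{n_1}),\qquad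 \Phi^2=g_2(\mathcal{F}^{n_1},\dots,\mathcal{F}^n=\widetilde{\mathcal{F}}^0,\widetilde{\mathcal{F}}^1,\dots,\widetilde{\mathcal{F}}^{\ell(w)}).$$ *)

(* Defs.v *)
From mathcomp Require Import all_boot all_order all_fingroup all_algebra.
From mathcomp Require Import zify.
From mathcomp Require Import boolp classical_sets.

Set Implicit Arguments.
Unset Strict Implicit.
Unset Printing Implicit Defensive.

Import GRing.Theory.
Local Open Scope ring_scope.

(* In MathComp (s * t) x = t (s x), so the product
   u v of the usual (right to left) convention is (v * u)%g here. *)
Section SymmetricGroup.
Variable k : nat.

Lemma simple_lt (i : 'I_k.-1) : (i.+1 < k)%N.
Proof. by rewrite -ltn_predRL. Qed.

(* The generators are indexed from 0: simple i exchanges i and i.+1. *)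
Definition simple (i : 'I_k.-1) : 'S_k :=
  tperm (widen_ord (leq_pred k) i) (Ordinal (simple_lt i)).

(* s_{b_1} o ... o s_{b_m}; the reversal accounts for MathComp's product. *)
Definition word_perm (b : seq 'I_k.-1) : 'S_k :=
  (\prod_(i <- rev b) simple i)%g.

Definition inversions (w : 'S_k) : {set 'I_k * 'I_k} :=
  [set p : 'I_k * 'I_k | (p.1 < p.2)%N && (w p.2 < w p.1)%N].

(* Coxeter length: see ell_word_perm_le and ell_reduced_ex below. *)
Definition ell (w : 'S_k) : nat := #|inversions w|.

Definition w0 : 'S_k := perm (@rev_ord_inj k).

Definition reduced_word (b : seq 'I_k.-1) (w : 'S_k) : Prop :=
  word_perm b = w /\ size b = ell w.

(* Reduced words of w0 having a reduced word of w as a prefix. *)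
Definition reduced_through (a : seq 'I_k.-1) (w : 'S_k) : Prop :=
  reduced_word a w0 /\ word_perm (take (ell w) a) = w.

Lemma word_perm_nil : word_perm [::] = 1%g.
Proof. by rewrite /word_perm big_nil. Qed.

Lemma word_perm_rcons b i : word_perm (rcons b i) = (simple i * word_perm b)%g.
Proof. by rewrite /word_perm rev_rcons big_cons. Qed.

Lemma word_permE b1 b2 x :
  word_perm (b1 ++ b2) x = word_perm b1 (word_perm b2 x).
Proof. by rewrite /word_perm rev_cat big_cat permM. Qed.

Lemma ell1 : ell 1%g = 0%N.
Proof.
apply/eqP; rewrite cards_eq0; apply/eqP/setP => -[x y].
by rewrite !inE /= !perm1; case: ltngtP.
Qed.

Lemma ell_w0_max w : (ell w <= ell w0)%N.
Proof.
apply/subset_leq_card/fintype.subsetP => -[x y]; rewrite !inE /= => /andP[xy _].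
by rewrite xy !permE /= ltn_sub2l ?ltnS // (leq_ltn_trans _ (ltn_ord y)).
Qed.

Lemma reduced_through1 a : reduced_word a w0 -> reduced_through a 1%g.
Proof. by move=> ra; split=> //; rewrite ell1 take0 word_perm_nil. Qed.

Lemma reduced_through_w0 a : reduced_word a w0 -> reduced_through a w0.
Proof. by move=> ra; split=> //; case: ra => aw <-; rewrite take_size. Qed.

Let lo (i : 'I_k.-1) : 'I_k := widen_ord (leq_pred k) i.
Let hi (i : 'I_k.-1) : 'I_k := Ordinal (simple_lt i).

Lemma val_simple i (x : 'I_k) : simple i x =
  (if x == i :> nat then i.+1 else if x == i.+1 :> nat then i : nat else x) :> nat.
Proof.
rewrite /simple; case: tpermP => [->|->|/eqP + /eqP +] /=.
- by rewrite eqxx.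
- by rewrite eqxx gtn_eqF.
- by rewrite -!val_eqE /= => /negPf-> /negPf->.
Qed.

Lemma card_inv_simple_le i w :
  (#|inversions (simple i * w)%g :\ (lo i, hi i)|
     <= #|inversions w :\ (lo i, hi i)|)%N.
Proof.
pose f (p : 'I_k * 'I_k) := (simple i p.1, simple i p.2).
have f_inj : injective f.
  by move=> [x y] [x' y'] [/perm_inj-> /perm_inj->].
rewrite -(card_imset _ f_inj); apply/subset_leq_card/fintype.subsetP => q.
case/imsetP => -[x y]; rewrite !inE !permM => /andP[+ /andP[/= xy inv]] ->.
rewrite /f /= inv andbT !xpair_eqE -!val_eqE /= !val_simple.
have [?|?] := x =P i :> nat; have [?|?] := x =P i.+1 :> nat;
  have [?|?] := y =P i :> nat; have [?|?] := y =P i.+1 :> nat; lia.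
Qed.

Lemma card_inv_simple i w :
  #|inversions (simple i * w)%g :\ (lo i, hi i)|
    = #|inversions w :\ (lo i, hi i)|.
Proof.
apply/eqP; rewrite eqn_leq card_inv_simple_le /=.
by have := card_inv_simple_le i (simple i * w)%g; rewrite mulgA tperm2 mul1g.
Qed.

Lemma ell_simple_le i w : (ell (simple i * w)%g <= (ell w).+1)%N.
Proof.
rewrite /ell (cardsD1 (lo i, hi i)) card_inv_simple.
rewrite (cardsD1 (lo i, hi i) (inversions w)) -addSn leq_add2r.
by case: (_ \in _).
Qed.

Lemma ell_simple_descent i (w : 'S_k) : (w (hi i) < w (lo i))%N ->
  ell w = (ell (simple i * w)%g).+1.
Proof.
move=> desc; rewrite /ell (cardsD1 (lo i, hi i)) -card_inv_simple.
rewrite (cardsD1 (lo i, hi i) (inversions (simple i * w)%g)) -addSn.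
by rewrite !inE !permM tpermL tpermR /= desc ltnS leqnn ltnNge ltnW.
Qed.

Lemma ell_word_perm_le b : (ell (word_perm b) <= size b)%N.
Proof.
elim/last_ind: b => [|b i IH]; first by rewrite word_perm_nil ell1.
by rewrite word_perm_rcons size_rcons (leq_trans (ell_simple_le _ _)).
Qed.

Lemma no_descent_eq1 (w : 'S_k) :
  (forall i, (w (lo i) < w (hi i))%N) -> w = 1%g.
Proof.
move=> asc.
have mono (x y : 'I_k) : (x < y)%N -> (w x < w y)%N.
  case: y => n; elim: n => [|n IH] //= ltnk; rewrite ltnS => le_xn.
  have ltn : (n < k.-1)%N by rewrite ltn_predRL.
  have := asc (Ordinal ltn); rewrite /lo /hi.
  set u := widen_ord _ _; set v := Ordinal _ => uv.
  have -> : Ordinal ltnk = v by apply: val_inj.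
  move: le_xn; rewrite leq_eqVlt => /orP[/eqP xn|lt_xn].
    by have -> : x = u by apply: val_inj.
  have := IH (ltnW ltnk) lt_xn.
  have -> : Ordinal (ltnW ltnk) = u by apply: val_inj.
  by move/ltn_trans; apply.
have ge_id (v : 'S_k) : (forall x y : 'I_k, (x < y)%N -> (v x < v y)%N) ->
    forall x : 'I_k, (x <= v x)%N.
  move=> vm [n]; elim: n => [|n IH] // ltnk.
  have := IH (ltnW ltnk); have := vm (Ordinal (ltnW ltnk)) (Ordinal ltnk).
  by move=> /= /(_ (ltnSn n)) h1 h2; apply: leq_ltn_trans h2 h1.
have vm (x y : 'I_k) : (x < y)%N -> ((w^-1)%g x < (w^-1)%g y)%N.
  rewrite !ltnNge; apply: contra; rewrite leq_eqVlt => /orP[/eqP/val_inj|].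
    by move/perm_inj->.
  by move/mono; rewrite !permKV => /ltnW.
apply/permP => x; rewrite perm1; apply: val_inj => /=.
apply/eqP; rewrite eqn_leq ge_id // andbT.
by have := ge_id _ vm (w x); rewrite permK.
Qed.

Lemma ell_reduced_ex w : exists b, reduced_word b w.
Proof.
move: {2}(ell w) (erefl (ell w)) => n; elim: n w => [|n IH] w ell_w;
  have [i desc|asc] := pickP (fun i => (w (hi i) < w (lo i))%N).
- by move: ell_w; rewrite (ell_simple_descent desc).
- exists [::]; suff -> : w = 1%g by split; rewrite ?word_perm_nil ?ell1.
  apply: no_descent_eq1 => i; rewrite ltn_neqAle leqNgt asc andbT.
  by apply/eqP => /val_inj/perm_inj/eqP; rewrite -val_eqE /= ltn_eqF.
- have [b [bw sb]] : exists b, reduced_word b (simple i * w)%g.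
    by apply: IH; move: ell_w; rewrite (ell_simple_descent desc) => -[].
  exists (rcons b i); split; last by rewrite size_rcons sb -ell_simple_descent.
  by rewrite word_perm_rcons bw mulgA tperm2 mul1g.
- exfalso; suff w1 : w = 1%g by rewrite w1 ell1 in ell_w.
  apply: no_descent_eq1 => i; rewrite ltn_neqAle leqNgt asc andbT.
  by apply/eqP => /val_inj/perm_inj/eqP; rewrite -val_eqE /= ltn_eqF.
Qed.
End SymmetricGroup.

Arguments w0 : clear implicits.

Section Flags.
Variables (K : fieldType) (k : nat).

(* A sequence V_0, ..., V_k of subspaces of the column space K^k. *)
Definition flag := {ffun 'I_k.+1 -> {vspace 'cV[K]_k}}.

Definition is_flag (V : flag) : Prop :=
  (forall j, \dim (V j) = j) /\
  (forall i j : 'I_k.+1, (i <= j)%N -> (V i <= V j)%VS).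

Definition flag_of (M : 'M[K]_k) : flag :=
  [ffun j : 'I_k.+1 => <<[seq col i M | i : 'I_k <- enum 'I_k & (i < j)%N]>>%VS].

Definition flag_act (g : 'M[K]_k) (V : flag) : flag :=
  [ffun j => (linfun (mulmx g) @: V j)%VS].

(* The matrix e_i |-> e_(w i), which is the transpose of perm_mx w. *)
Definition pmat (w : 'S_k) : 'M[K]_k := \matrix_(i, j) (i == w j)%:R.

Definition Fstd : flag := flag_of 1%:M.
Definition Fant : flag := flag_of (pmat (w0 k)).

Definition rel_pos (w : 'S_k) (V V' : flag) : Prop :=
  exists g : 'M[K]_k, [/\ g \in unitmx, flag_act g V = Fstd &
                          flag_act g V' = flag_of (pmat w)].

Definition transverse (V V' : flag) : Prop := rel_pos (w0 k) V V'.

Definition lower_unitri (L : 'M[K]_k) : Prop :=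
  (forall i, L i i = 1) /\ (forall i j : 'I_k, (i < j)%N -> L i j = 0).

(* The unique lower unitriangular L such that V is the flag of M L; it exists
   when M is invertible and V is transverse to the antistandard flag moved
   by M. *)
Definition lower_part (M : 'M[K]_k) (V : flag) : 'M[K]_k :=
  xget 1%:M [set L | lower_unitri L /\ V = flag_of (M *m L)]%classic.

(* Tuples (F^0, ..., F^n) are sequences of n.+1 flags. *)
Definition nthF (Fs : seq flag) (j : nat) : flag := nth Fstd Fs j.
Definition lastF (Fs : seq flag) : flag := last Fstd Fs.

Definition chain (b : seq 'I_k.-1) (Fs : seq flag) : Prop :=
  [/\ size Fs = (size b).+1,
      forall V, V \in Fs -> is_flag V &
      forall j : 'I_(size b), rel_pos (simple (tnth (in_tuple b) j))
                                (nthF Fs j) (nthF Fs j.+1)].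

(* The unique chain from V to V', both ends included; it exists when b is a
   reduced word of w and V, V' are in relative position w. *)
Definition the_chain (b : seq 'I_k.-1) (V V' : flag) : seq flag :=
  xget [::] [set Fs | [/\ chain b Fs, nthF Fs 0 = V & lastF Fs = V']]%classic.

Definition X (b : seq 'I_k.-1) : set (seq flag) :=
  [set Fs | [/\ chain b Fs, nthF Fs 0 = Fstd & lastF Fs = Fant]]%classic.

Definition BS (b : seq 'I_k.-1) : set (seq flag) :=
  [set Fs | [/\ chain b Fs, nthF Fs 0 = Fstd &
                transverse (lastF Fs) Fant]]%classic.

(* In the maps below, D is a reduced word of w0. *)
Definition phi1 (D : seq 'I_k.-1) (Fs : seq flag) : seq flag :=
  Fs ++ behead (the_chain D (lastF Fs) Fant).

Definition phi2 (D : seq 'I_k.-1) (Fs : seq flag) : seq flag :=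
  let L' := lower_part 1%:M (lastF Fs) in
  let Gs := [seq flag_act (pmat (w0 k) *m invmx L') V | V <- Fs] in
  take (size D) (the_chain D Fstd (nthF Gs 0)) ++ Gs.

Definition U_BS (b : seq 'I_k.-1) (r1 : nat) : set (seq flag) :=
  [set Fs | BS b Fs /\ transverse (nthF Fs r1) Fant]%classic.

Definition Phi_BS (r1 : nat) (Fs : seq flag) : seq flag * seq flag :=
  let L1 := lower_part 1%:M (nthF Fs r1) in
  (take r1.+1 Fs, [seq flag_act (invmx L1) V | V <- drop r1 Fs]).

Definition U_X (b : seq 'I_k.-1) (n1 : nat) (w : 'S_k) : set (seq flag) :=
  [set Fs | X b Fs /\
     transverse (nthF Fs n1) (flag_of (pmat (w0 k) *m pmat w))]%classic.

Definition Ftilde (a : seq 'I_k.-1) (j : nat) : flag :=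
  flag_of (pmat (w0 k) *m pmat (word_perm (take j a))).

(* Here a is a reduced word of w0 through w. The common entries
   Ftilde^(ell w0) = F^0 and F^n = Ftilde^0 are listed only once. *)
Definition Phi_X (a : seq 'I_k.-1) (n1 : nat) (w : 'S_k) (Fs : seq flag) :
    seq flag * seq flag :=
  let M := pmat (w0 k) *m pmat w *m pmat (w0 k) in
  let L := lower_part M (nthF Fs n1) in
  let g2 := invmx (M *m L) in
  let g1 := pmat (w0 k) *m g2 in
  ([seq flag_act g1 V |
      V <- [seq Ftilde a j | j <- iota (ell w) (ell (w0 k) - ell w)]
             ++ take n1.+1 Fs],
   [seq flag_act g2 V |
      V <- drop n1 Fs ++ [seq Ftilde a j | j <- iota 1 (ell w)]]).

Lemma flag_act_of (g M : 'M[K]_k) : flag_act g (flag_of M) = flag_of (g *m M).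
Proof.
apply/ffunP => j; rewrite !ffunE limg_span -map_comp; congr <<_>>%VS.
by apply: eq_map => i; rewrite /= lfunE /= !colE mulmxA.
Qed.

Lemma pmatM (u v : 'S_k) : pmat u *m pmat v = pmat (v * u)%g.
Proof.
apply/matrixP => i j; rewrite !mxE (bigD1 (v j)) //= !mxE eqxx mulr1 permM.
by rewrite big1 ?addr0 // => l /negPf; rewrite !mxE => ->; rewrite mulr0.
Qed.

Lemma is_flag_of (M : 'M[K]_k) : M \in unitmx -> is_flag (flag_of M).
Proof.
move=> Mu.
have szj (j : 'I_k.+1) : size [seq i : 'I_k <- enum 'I_k | (i < j)%N] = j.
  rewrite size_filter -(count_map val (fun l => (l < j)%N)) val_enum_ord.
  by rewrite -size_filter (@filter_iota_ltn 0 k j) ?size_iota // -ltnS.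
split=> [j|i j le_ij]; last first.
  rewrite !ffunE; apply: sub_span => _ /mapP[l + ->].
  rewrite mem_filter => /andP[lt_li _]; apply: map_f.
  by rewrite mem_filter mem_enum (leq_trans lt_li).
rewrite ffunE; set s := [seq _ | _ <- _ & _].
pose t := [seq col i M | i : 'I_k <- enum 'I_k & ~~ (i < j)%N].
have st : (size s + size t)%N = k.
  rewrite !size_map !size_filter -[RHS](size_enum_ord k).
  exact: count_predC.
have full : (fullv <= <<s>> + <<t>>)%VS.
  apply/subvP => v _; rewrite -[v](mulKVmx Mu).
  have -> : M *m (invmx M *m v) = \sum_i (invmx M *m v) i 0 *: col i M.
    apply/matrixP => a b; rewrite summxE !mxE; apply: eq_bigr => i _.
    by rewrite !mxE !ord1 mulrC.
  rewrite -span_cat; apply: memv_suml => i _; apply/memvZ/memv_span.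
  rewrite mem_cat; have [lt_ij|ge_ij] := boolP (i < j)%N.
    apply/orP; left; apply/mapP; exists i => //.
    by rewrite mem_filter lt_ij mem_enum.
  apply/orP; right; apply/mapP; exists i => //.
  by rewrite mem_filter ge_ij mem_enum.
have ss : size s = j by rewrite size_map szj.
have := dimvS full; rewrite dimvf /dim /= muln1 => le_k.
apply/eqP; rewrite eqn_leq -[X in (_ <= X)%N]ss dim_span /=.
rewrite -(leq_add2r (size t)) -[X in (X + _)%N]ss st (leq_trans le_k) //.
apply: leq_trans (dimv_add_leqif _ _) _.
by rewrite leq_add2l dim_span.
Qed.
End Flags.

Arguments Fstd {K k}.
Arguments Fant {K k}.
Arguments X K {k}.
Arguments BS K {k}.
Arguments U_BS K {k}.
Arguments U_X K {k}.

(* Main.v *)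
Require Import Defs.
From mathcomp Require Import all_boot all_order all_fingroup all_algebra.
From mathcomp Require Import boolp classical_sets zify.

Local Open Scope classical_set_scope.

(** Once a word D for w0 is reduced, a chain of flags of type D is rigid: it is
determined by its two ends, and it is a translate
  g F(e), g F(s_1), g F(s_1 s_2), ..., g F(w0)
of the coordinate chain (the_chainE).  So every chain chosen in the maps phi1
and phi2 becomes an explicit std_chain g D, and GL(k) acts on such chains by
left multiplication on g (std_chain_act).

Rigidity is a consequence of the Bruhat relations.  Two invertible matrices
define the same flag iff they differ on the right by an upper triangular matrix
(flag_of_eqP).  Let B be the group of these.  If u s_i is longer than u, then u
conjugates the root subgroup of position (i, i + 1) into B, so that
B u B s_i B = B u s_i B; this is rel_pos_simple_ascent, and by induction on the
word every chain of reduced type is a translated coordinate chain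
(reduced_chainE).  Uniqueness (std_chain_eq) holds because a matrix fixing
F(e) and F(w) also fixes F(u) for every prefix u of a reduced word of w
(upper_tri_conj_ascent is the step from w to its longest proper prefix).

On the other side, the flags transverse to F(w0) are the F(L) with L lower
unitriangular (transverse_antP), L is unique (lower_partE), and lower
unitriangular matrices fix F(w0).  For a point of the open set U, write L1 for
the matrix of its flag of index r1 and L for that of its last flag.  Then
phi1 appends the tail of std_chain L D, while phi2 acts by w0 L^-1 and prepends
std_chain (w0 L^-1 w0) D; on the spliced pair the same formulas hold with L1
for the first half and L1^-1 L for the second half.  The chain Ftilde is
std_chain w0 D, so each diagram reduces to a computation of the matrix g2:
it is L1^-1 in the first one, and in the second one
  g2 = (w0 L^-1 L1)^-1 = L1^-1 L w0,   g2 (w0 L^-1) = L1^-1. *)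

Section BraidVarieties.
Set Implicit Arguments.
Unset Strict Implicit.
Unset Printing Implicit Defensive.
Import GRing.Theory.
Local Open Scope ring_scope.
Variables (K : fieldType) (k : nat).
Implicit Types (g h M N T L : 'M[K]_k) (u w : 'S_k) (b D : seq 'I_k.-1).
Implicit Types (V W : flag K k) (A C Fs : seq (flag K k)).
Local Notation pw0 := (pmat K (w0 k)).
Local Notation lo i := (widen_ord (leq_pred k) i).
Local Notation hi i := (Ordinal (simple_lt i)).

(** * The action on flags and permutation matrices *)

Lemma flag_actM g h V : flag_act g (flag_act h V) = flag_act (g *m h) V.
Proof.
apply/ffunP => j; rewrite !ffunE -limg_comp; congr (_ @: _)%VS.
by apply/lfunP => v; rewrite comp_lfunE !lfunE /= mulmxA.
Qed.

Lemma flag_act1 V : flag_act 1%:M V = V.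
Proof.
apply/ffunP => j; rewrite ffunE -[RHS]lim1g; congr (_ @: _)%VS.
by apply/lfunP => v; rewrite !lfunE /= mul1mx.
Qed.

Lemma flag_actK g : g \in unitmx ->
  cancel (@flag_act K k g) (flag_act (invmx g)).
Proof. by move=> gu V; rewrite flag_actM mulVmx ?flag_act1. Qed.

Lemma is_flag_act g V : g \in unitmx -> is_flag V -> is_flag (flag_act g V).
Proof.
move=> gu [dimV incV]; split=> [j|i j le_ij]; last first.
  by rewrite !ffunE limgS ?incV.
rewrite ffunE limg_dim_eq ?dimV //.
suff /eqP-> : lker (linfun (mulmx g : 'cV[K]_k -> 'cV[K]_k)) == 0%VS.
  by rewrite capv0.
apply/lker0P => v v'; rewrite !lfunE /= => /(congr1 (mulmx (invmx g))).
by rewrite !mulKmx.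
Qed.

Lemma invmx_mul M N : M \in unitmx -> N \in unitmx ->
  invmx (M *m N) = invmx N *m invmx M.
Proof.
move=> Mu Nu; have MNu : M *m N \in unitmx by rewrite unitmx_mul Mu.
apply: (can_inj (mulKmx MNu)).
by rewrite mulmxV // mulmxA -(mulmxA M) mulmxV // mulmx1 mulmxV.
Qed.

Lemma pmat1 : pmat K (1 : 'S_k)%g = 1%:M.
Proof. by apply/matrixP => i j; rewrite !mxE perm1. Qed.

Lemma pmatVK w : pmat K w *m pmat K w^-1%g = 1%:M.
Proof. by rewrite pmatM mulVg pmat1. Qed.

Lemma pmat_unit w : pmat K w \in unitmx.
Proof. by have [] := mulmx1_unit (pmatVK w). Qed.

Lemma invmx_pmat w : invmx (pmat K w) = pmat K w^-1%g.
Proof. by rewrite -[RHS](mulKmx (pmat_unit w)) pmatVK mulmx1. Qed.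

Lemma w0K : (w0 k * w0 k)%g = 1%g.
Proof. by apply/permP => i; rewrite permM !permE rev_ordK. Qed.

Lemma pw0K : pw0 *m pw0 = 1%:M.
Proof. by rewrite pmatM w0K pmat1. Qed.

Lemma pmatV_perm_mx w : pmat K w^-1%g = perm_mx w.
Proof.
by apply/matrixP => i j; rewrite !mxE -(inj_eq (@perm_inj _ w)) permKV.
Qed.

Lemma pmat_conjE w M i j :
  (pmat K w^-1%g *m M *m pmat K w) i j = M (w i) (w j).
Proof.
by rewrite -{2}[w]invgK !pmatV_perm_mx -row_permE -col_permE !mxE.
Qed.

(** * Equality of flags and upper triangular matrices *)

Definition upper_tri T := forall i j : 'I_k, (j < i)%N -> T i j = 0.

Lemma upper_tri_diag T i : T \in unitmx -> upper_tri T -> T i i != 0.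
Proof.
move=> Tu Tup; have /det_trig detT : is_trig_mx T^T.
  by apply/is_trig_mxP => a c lt_ac; rewrite mxE Tup.
move: Tu; rewrite unitmxE -det_tr detT unitfE => /prodf_neq0/(_ i isT).
by rewrite mxE.
Qed.

Lemma mem_flag_of M (i : 'I_k) (j : 'I_k.+1) : (i < j)%N ->
  col i M \in flag_of M j.
Proof.
move=> ij; rewrite ffunE; apply/memv_span/map_f.
by rewrite mem_filter ij mem_enum.
Qed.

(** Stated as an equality of flags, triangularity is visibly stable under
products and inverses, since T stabilises the standard flag. *)
Lemma flag_of_stdP T : T \in unitmx -> flag_of T = Fstd <-> upper_tri T.
Proof.
move=> Tu; split=> [TF i j lt_ji|Tup].
  have := @mem_flag_of T j (lift ord0 j); rewrite TF ffunE => /(_ (leqnn _)) Tj.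
  (* The coordinate i vanishes on the span of e_0, ..., e_j. *)
  pose coord_i : 'cV[K]_k -> 'cV[K]_k := mulmx (delta_mx i i : 'M[K]_k).
  have : (<<[seq col l (1%:M : 'M[K]_k) |
             l : 'I_k <- enum 'I_k & (l < lift ord0 j)%N]>>
     <= lker (linfun coord_i))%VS.
    apply/span_subvP => _ /mapP[l + ->].
    rewrite mem_filter => /andP[/= lt_lj _].
    rewrite memv_ker lfunE /= colE mul1mx mul_delta_mx_0 //.
    by rewrite -val_eqE /= gtn_eqF // (leq_trans lt_lj).
  move=> /subvP/(_ _ Tj); rewrite memv_ker lfunE /= => /eqP/matrixP/(_ i 0).
  rewrite !mxE (bigD1 i) //= big1 ?addr0 => [|l /negPf]; rewrite !mxE ?eqxx.
    by rewrite mul1r.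
  by move=> ->; rewrite mul0r.
have [dimT _] := is_flag_of Tu.
have [dim1 _] := @is_flag_of K k _ (unitmx1 _ _).
apply/ffunP => j; apply/eqP; rewrite eqEdim dimT dim1 leqnn andbT.
rewrite [X in (X <= _)%VS]ffunE; apply/span_subvP => _ /mapP[l + ->].
rewrite mem_filter => /andP[/= lt_lj _].
have -> : col l T = \sum_i T i l *: col i 1%:M.
  apply/matrixP => a c; rewrite summxE !mxE (bigD1 a) //= !mxE eqxx mulr1.
  rewrite big1 ?addr0 // => i /negPf; rewrite !mxE eq_sym => ->.
  by rewrite mulr0.
apply: memv_suml => i _; have [le_il|lt_li] := leqP i l.
  by apply/memvZ/mem_flag_of/(leq_ltn_trans le_il).
by rewrite Tup // scale0r mem0v.
Qed.

Lemma flag_of_eqP M N : M \in unitmx -> N \in unitmx ->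
  flag_of M = flag_of N <-> upper_tri (invmx M *m N).
Proof.
move=> Mu Nu; rewrite -flag_of_stdP ?unitmx_mul ?unitmx_inv ?Mu //.
rewrite -flag_act_of; split=> [<-|/(congr1 (flag_act M))].
  by rewrite flag_act_of mulVmx.
by rewrite flag_actM mulmxV // flag_act1 flag_act_of mulmx1.
Qed.

(** * Relative position *)

(** A pair of flags in relative position w is a translate of
(F(e), F(w)); the translating matrix is easier to compute with than the matrix
that moves the pair to the standard one. *)
Lemma rel_posP w V V' : rel_pos w V V' <->
  exists M, [/\ M \in unitmx, V = flag_of M & V' = flag_of (M *m pmat K w)].
Proof.
split=> [[g [gu gV gV']]|[M [Mu -> ->]]].
  exists (invmx g); rewrite unitmx_inv; split=> //.
    by rewrite -[LHS](flag_actK gu) gV flag_act_of mulmx1.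
  by rewrite -[LHS](flag_actK gu) gV' flag_act_of.
exists (invmx M); rewrite unitmx_inv !flag_act_of mulmxA mulVmx // mul1mx.
by split.
Qed.

Lemma rel_pos_act w h V V' : h \in unitmx -> rel_pos w V V' ->
  rel_pos w (flag_act h V) (flag_act h V').
Proof.
move=> hu /rel_posP[M [Mu -> ->]]; apply/rel_posP; exists (h *m M).
by rewrite unitmx_mul hu !flag_act_of mulmxA.
Qed.

(** * Ascents in the symmetric group *)

(** A simple transposition reverses only one pair, which is why
passing from u to u s_i changes a triangularity condition in one entry. *)
Lemma simple_ltn_or (i : 'I_k.-1) (a c : 'I_k) : (c < a)%N ->
  (simple i c < simple i a)%N \/ a = hi i /\ c = lo i.
Proof.
move=> lt_ca.
have [/andP[/eqP-> /eqP->]|] := boolP ((a == hi i) && (c == lo i)).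
  by right.
rewrite -!val_eqE /= !val_simple => ne; left.
have [?|?] := a =P i :> nat; have [?|?] := a =P i.+1 :> nat;
  have [?|?] := c =P i :> nat; have [?|?] := c =P i.+1 :> nat; lia.
Qed.

(** Otherwise the last letter would lower the length, and the whole
word could not be reduced. *)
Lemma reduced_word_rcons b i w : reduced_word (rcons b i) w ->
  reduced_word b (word_perm b) /\ (word_perm b (lo i) < word_perm b (hi i))%N.
Proof.
case=> <- szb; move: szb; rewrite word_perm_rcons size_rcons => szb.
have le_b := ell_word_perm_le b.
split; first split=> //.
  by apply/eqP; rewrite eqn_leq le_b andbT -ltnS szb ell_simple_le.
rewrite ltnNge; apply/negP; rewrite leq_eqVlt => /orP[/eqP/val_inj/perm_inj|].
  by move/(congr1 val) => /= /eqP; rewrite gtn_eqF.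
move/ell_simple_descent => e; move: le_b; rewrite e -szb.
by rewrite ltnNge leqnSn.
Qed.

(** By simple_ltn_or only one entry is not covered by the hypothesis on u s_i:
the entry of T in position (u (i + 1), u i), which lies below the diagonal
because i is an ascent of u.  In terms of flags, T fixes F(u) as soon as it
fixes F(e) and F(u s_i). *)
Lemma upper_tri_conj_ascent u i T : (u (lo i) < u (hi i))%N -> upper_tri T ->
  upper_tri (pmat K (simple i * u)^-1%g *m T *m pmat K (simple i * u)%g) ->
  upper_tri (pmat K u^-1%g *m T *m pmat K u).
Proof.
move=> asc Tup Twup a c lt_ca; rewrite pmat_conjE.
have [lt_s|[-> ->]] := simple_ltn_or i lt_ca; last exact: Tup.
by have := Twup _ _ lt_s; rewrite pmat_conjE !permM !tpermK.
Qed.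

(** * Coordinate chains *)

Lemma flag_of_pmat_eqP M N w : M \in unitmx -> N \in unitmx ->
  flag_of (M *m pmat K w) = flag_of (N *m pmat K w) <->
  upper_tri (pmat K w^-1%g *m (invmx M *m N) *m pmat K w).
Proof.
move=> Mu Nu; rewrite flag_of_eqP ?unitmx_mul ?Mu ?Nu ?pmat_unit //.
by rewrite invmx_mul ?pmat_unit // invmx_pmat !mulmxA.
Qed.

(** When b is reduced, every chain of type b has this form: reduced_chainE. *)
Definition std_chain g b : seq (flag K k) :=
  [seq flag_of (g *m pmat K (word_perm (take j b))) | j <- iota 0 (size b).+1].

Lemma size_std_chain g b : size (std_chain g b) = (size b).+1.
Proof. by rewrite size_map size_iota. Qed.

Lemma nth_std_chain g b j : (j <= size b)%N ->
  nthF (std_chain g b) j = flag_of (g *m pmat K (word_perm (take j b))).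
Proof.
by move=> le_jb; rewrite /nthF (nth_map 0%N) ?size_iota // nth_iota.
Qed.

Lemma std_chain_rcons g b i : std_chain g (rcons b i) =
  rcons (std_chain g b) (flag_of (g *m pmat K (word_perm (rcons b i)))).
Proof.
rewrite /std_chain size_rcons -[in LHS]addn1 iotaD map_cat cats1 add0n.
congr rcons; last by rewrite take_oversize ?size_rcons.
apply/eq_in_map => j; rewrite mem_iota ltnS => /= le_jb.
by rewrite -cats1 takel_cat.
Qed.

Lemma last_std_chain g b :
  lastF (std_chain g b) = flag_of (g *m pmat K (word_perm b)).
Proof.
rewrite /lastF -nth_last size_std_chain -[LHS]/(nthF _ _) nth_std_chain //.
by rewrite take_size.
Qed.

Lemma std_chain_act h g b :
  [seq flag_act h V | V <- std_chain g b] = std_chain (h *m g) b.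
Proof.
by rewrite -map_comp; apply: eq_map => j; rewrite /= flag_act_of mulmxA.
Qed.

(** Uniqueness of a chain of reduced type with given ends.  The
matrix g^-1 h fixes F(e) and F(w), so it fixes the flags of all prefixes of b,
by descending along the word. *)
Lemma std_chain_eq b w g h : reduced_word b w -> g \in unitmx -> h \in unitmx ->
  flag_of g = flag_of h -> flag_of (g *m pmat K w) = flag_of (h *m pmat K w) ->
  std_chain g b = std_chain h b.
Proof.
move=> + gu hu gh; elim/last_ind: b w => [|b i IH] w.
  by move=> _ _; rewrite /std_chain /= word_perm_nil pmat1 !mulmx1 gh.
move=> rb gwhw; rewrite !std_chain_rcons (proj1 rb) gwhw.
congr rcons; have [rb' asc] := reduced_word_rcons rb; apply: IH rb' _.
move: gwhw; rewrite -(proj1 rb) word_perm_rcons => /(flag_of_pmat_eqP _ gu hu).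
move=> gwhw; apply/flag_of_pmat_eqP => //.
by apply: upper_tri_conj_ascent gwhw => //; apply/flag_of_eqP.
Qed.

(** * Chains of reduced type are coordinate chains *)

(** The Bruhat relation B u B s_i B = B u s_i B for an ascent: a step
of type s_i from g F(u) is again a coordinate step, at the price of changing g
to some h that moves F(e) and F(u) in the same way. *)
Lemma rel_pos_simple_ascent g u i V : g \in unitmx -> (u (lo i) < u (hi i))%N ->
  rel_pos (simple i) (flag_of (g *m pmat K u)) V ->
  exists h, [/\ h \in unitmx, flag_of h = flag_of g,
    flag_of (h *m pmat K u) = flag_of (g *m pmat K u)
    & V = flag_of (h *m pmat K (simple i * u)%g)].
Proof.
move=> gu asc /rel_posP[M [Mu guM ->]].
have guu : g *m pmat K u \in unitmx by rewrite unitmx_mul gu pmat_unit.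
set T := invmx (g *m pmat K u) *m M.
have Tu : T \in unitmx by rewrite unitmx_mul unitmx_inv guu.
have Tup : upper_tri T by apply/flag_of_eqP.
have dT := upper_tri_diag (hi i) Tu Tup.
(* T carries (F(e), F(s_i)) to the given pair, read in the frame g u.  The
   elementary matrix x is chosen with x^-1 T zero in position (i, i + 1), so
   that x^-1 T fixes F(s_i); and u x u^-1 is still upper triangular. *)
pose t := T (lo i) (hi i) / T (hi i) (hi i).
have lohi : (lo i == hi i) = false by rewrite -val_eqE /= ltn_eqF.
pose E : 'M[K]_k := delta_mx (lo i) (hi i).
pose x := 1%:M + t *: E; pose y := 1%:M - t *: E.
have EE : E *m E = 0 by rewrite mul_delta_mx_0 // eq_sym lohi.
have yx : y *m x = 1%:M.
  rewrite mulmxBl mul1mx mulmxDr mulmx1 -scalemxAl -scalemxAr EE !scaler0.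
  by rewrite addr0 addrK.
have [yu xu] := mulmx1_unit yx.
have xV : invmx x = y by rewrite -[LHS]mul1mx -yx mulmxK.
have yTE a c : (y *m T) a c = T a c - t * (a == lo i)%:R * T (hi i) c.
  rewrite mulmxBl mul1mx -scalemxAl !mxE; congr (_ - _).
  rewrite -mulrA; congr (_ * _).
  rewrite (bigD1 (hi i)) //= big1 => [|l /negPf nl].
    by rewrite !mxE eqxx andbT addr0.
  rewrite !mxE.
  by rewrite nl andbF mul0r.
have yTup : upper_tri (y *m T).
  move=> a c lt_ca; rewrite yTE Tup // sub0r; apply/eqP; rewrite oppr_eq0.
  have [al|] := eqVneq a (lo i); last by rewrite mulr0 mul0r.
  rewrite Tup ?mulr0 //; apply: leq_trans lt_ca _; rewrite al /=; exact: leqnSn.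
pose h := g *m (pmat K u *m x *m pmat K u^-1%g).
have uV : pmat K u^-1%g *m pmat K u = 1%:M by rewrite pmatM mulgV pmat1.
have huE : h *m pmat K u = g *m pmat K u *m x 
  by rewrite /h -!mulmxA uV mulmx1 !mulmxA.
have hu : h \in unitmx by rewrite !unitmx_mul gu xu !pmat_unit.
have gux : g *m pmat K u *m x \in unitmx by rewrite unitmx_mul guu.
exists h; split=> //.
- apply/esym/flag_of_eqP => //; rewrite /h mulKmx // => a c lt_ca.
  rewrite -{1}[u]invgK pmat_conjE !mxE (inj_eq (@perm_inj _ _)).
  rewrite -[a == c]val_eqE gtn_eqF //.
  case: andP => [[/eqP ea /eqP ec]|_]; last by rewrite mulr0 addr0.
  by move: lt_ca; rewrite -[a](permKV u) -[c](permKV u) ea ec ltnNge (ltnW asc).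
- rewrite huE; apply/esym/flag_of_eqP => //; rewrite mulKmx // => a c lt_ca.
  rewrite !mxE -[a == c]val_eqE gtn_eqF //; case: andP => [[/eqP ea /eqP ec]|_].
    by move: lt_ca; rewrite ea ec ltnNge leqnSn.
  by rewrite mulr0 addr0.
rewrite -pmatM mulmxA huE; apply/esym/flag_of_pmat_eqP => //.
have -> : invmx (g *m pmat K u *m x) *m M = y *m T.
    by rewrite invmx_mul // xV -mulmxA.
move=> a c lt_ca; rewrite pmat_conjE.
have [lt_s|[-> ->]] := simple_ltn_or i lt_ca; first exact: yTup.
by rewrite /simple tpermL tpermR yTE eqxx mulr1 divfK // subrr.
Qed.

Lemma chainP b A : chain b A <->
  [/\ size A = (size b).+1, forall V, V \in A -> is_flag V
    & forall i0 j, (j < size b)%N ->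
        rel_pos (simple (nth i0 b j)) (nthF A j) (nthF A j.+1)].
Proof.
split=> -[szA flA relA]; split=> //.
  by move=> i0 j lt_jb; have := relA (Ordinal lt_jb); rewrite (tnth_nth i0).
by move=> j; rewrite (tnth_nth (tnth (in_tuple b) j)); apply: relA.
Qed.

Lemma chain_cat b1 b2 A C : chain b1 A -> chain b2 C -> lastF A = nthF C 0 ->
  chain (b1 ++ b2) (A ++ behead C).
Proof.
move=> /chainP[szA flA relA] /chainP[szC flC relC] AC; apply/chainP; split.
- by rewrite !size_cat size_behead szA szC.
- move=> V; rewrite mem_cat => /orP[/flA//|/mem_behead/flC//].
have E2 j : (size b1 <= j)%N -> nthF (A ++ behead C) j = nthF C (j - size b1).
  rewrite leq_eqVlt => /orP[/eqP<-|lt_j].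
    by rewrite subnn -AC /nthF nth_cat szA ltnSn /lastF -nth_last szA.
  by rewrite /nthF nth_cat szA ltnNge lt_j /= nth_behead subnSK.
move=> i0 j; rewrite size_cat nth_cat.
case: (ltnP j (size b1)) => [lt_j _|le_j lt_j].
  by rewrite /nthF !nth_cat szA !ltnS (ltnW lt_j) lt_j; apply: relA.
by rewrite !E2 ?leqW // subSn //; apply: relC; rewrite ltn_subLR.
Qed.

Lemma chain_takel b1 b2 A :
  chain (b1 ++ b2) A -> chain b1 (take (size b1).+1 A).
Proof.
move=> /chainP[szA flA relA]; apply/chainP; split.
- by rewrite size_takel // szA size_cat ltnS leq_addr.
- by move=> V /mem_take/flA.
move=> i0 j lt_j; have := relA i0 j; rewrite size_cat ltn_addr // nth_cat lt_j.
by rewrite /nthF !nth_take ?ltnS ?(ltnW lt_j) // => /(_ isT).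
Qed.

Lemma chain_drop b1 b2 A : chain (b1 ++ b2) A -> chain b2 (drop (size b1) A).
Proof.
move=> /chainP[szA flA relA]; apply/chainP; split.
- by rewrite size_drop szA size_cat -addnS addKn.
- by move=> V /mem_drop/flA.
move=> i0 j lt_j; rewrite /nthF !nth_drop addnS.
have := relA i0 (size b1 + j)%N; rewrite size_cat ltn_add2l nth_cat.
by rewrite (ltnNge (_ + _)) leq_addr addKn; apply.
Qed.

Lemma nthF_act h A j : (j < size A)%N ->
  nthF [seq flag_act h V | V <- A] j = flag_act h (nthF A j).
Proof. by move=> lt_j; rewrite /nthF (nth_map Fstd). Qed.

Lemma lastF_act h A : A != [::] ->
  lastF [seq flag_act h V | V <- A] = flag_act h (lastF A).
Proof. by case: A => //= V A _; rewrite /lastF /= last_map. Qed.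

Lemma chain_neq0 b A : chain b A -> A != [::].
Proof. by case=> szA _ _; rewrite -size_eq0 szA. Qed.

Lemma chain_act h b A : h \in unitmx -> chain b A ->
  chain b [seq flag_act h V | V <- A].
Proof.
move=> hu /chainP[szA flA relA]; apply/chainP; split; first by rewrite size_map.
  by move=> _ /mapP[V /flA flV ->]; apply: is_flag_act.
move=> i0 j lt_j; rewrite !nthF_act ?szA ?ltnS // 1?ltnW //.
by apply: rel_pos_act => //; apply: relA.
Qed.

Lemma chain_std_chain g b : g \in unitmx -> chain b (std_chain g b).
Proof.
move=> gu; apply/chainP; split; first exact: size_std_chain.
  by move=> _ /mapP[j _ ->]; apply: is_flag_of; rewrite unitmx_mul gu pmat_unit.
move=> i0 j lt_j; rewrite (nth_std_chain _ lt_j) (nth_std_chain _ (ltnW lt_j)).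
rewrite (take_nth i0) //.
apply/rel_posP; exists (g *m pmat K (word_perm (take j b))).
by rewrite unitmx_mul gu pmat_unit -mulmxA pmatM word_perm_rcons.
Qed.

(** By induction on the word; the matrix given by the last step has to
be used for the whole chain, and std_chain_eq says that this does not change
the earlier flags. *)
Lemma reduced_chainE b w A M : reduced_word b w -> M \in unitmx -> chain b A ->
  nthF A 0 = flag_of M ->
  exists h, [/\ h \in unitmx, flag_of h = flag_of M & A = std_chain h b].
Proof.
move=> + Mu; elim/last_ind: b w A => [|b i IH] w A rb chA A0.
  exists M; split=> //; have [] := chA.
  case: A A0 {chA} => [|V []] //= A0 _ _ _.
  by rewrite /std_chain /= word_perm_nil pmat1 mulmx1 -A0.
have [rb' asc] := reduced_word_rcons rb.
rewrite -cats1 in chA; have chA' := chain_takel chA.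
have [szA _ relA] := (chainP _ _).1 chA; rewrite size_cat addn1 in szA relA.
have A0' : nthF (take (size b).+1 A) 0 = flag_of M by rewrite /nthF nth_take.
have [h [hu hM Ah]] := IH _ _ rb' chA' A0'.
have := relA i (size b) (ltnSn _); rewrite nth_cat ltnn subnn /=.
have -> : nthF A (size b) = flag_of (h *m pmat K (word_perm b)).
  by rewrite -last_std_chain -Ah /lastF -nth_last size_takel ?szA //= nth_take.
move=> /(rel_pos_simple_ascent hu asc)[h' [h'u h'h h'w last_h']].
exists h'; split; rewrite ?h'h // std_chain_rcons word_perm_rcons -last_h'.
rewrite -(std_chain_eq rb' hu h'u) // -Ah.
by rewrite /nthF -take_nth ?szA // take_oversize ?szA.
Qed.

Lemma the_chainE b w g V W : reduced_word b w -> g \in unitmx ->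
  V = flag_of g -> W = flag_of (g *m pmat K w) ->
  the_chain b V W = std_chain g b.
Proof.
move=> rb gu -> ->; apply: xget_unique.
  split; first exact: chain_std_chain.
    by rewrite nth_std_chain // take0 word_perm_nil pmat1 mulmx1.
  by rewrite last_std_chain (proj1 rb).
move=> A [chA A0 lastA]; have [h [hu hg Ah]] := reduced_chainE rb gu chA A0.
move: lastA; rewrite Ah last_std_chain (proj1 rb) => hgw.
exact: std_chain_eq rb hu gu hg hgw.
Qed.

(** * Lower unitriangular matrices and the antistandard flag *)

Lemma pw0_conjE M i j : (pw0 *m M *m pw0) i j = M (rev_ord i) (rev_ord j).
Proof.
have {1}-> : w0 k = (w0 k)^-1%g by apply/esym/eqP; rewrite eq_invg_mul w0K.
by rewrite pmat_conjE !permE.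
Qed.

(** Conjugation by w0 turns this into the description of the
stabiliser of the standard flag. *)
Lemma flag_act_antP M : M \in unitmx -> flag_act M Fant = Fant <->
  (forall i j : 'I_k, (i < j)%N -> M i j = 0).
Proof.
move=> Mu; rewrite /Fant flag_act_of.
have -> : M *m pw0 = pw0 *m (pw0 *m M *m pw0) by rewrite !mulmxA pw0K mul1mx.
rewrite -flag_act_of; have -> : flag_of pw0 = flag_act pw0 Fstd.
  by rewrite flag_act_of mulmx1.
transitivity (flag_of (pw0 *m M *m pw0) = Fstd).
  split=> [/(congr1 (flag_act pw0))|->//].
  by rewrite !flag_actM pw0K !flag_act1.
rewrite flag_of_stdP ?unitmx_mul ?pmat_unit ?Mu //; split=> low i j lt.
  have := low (rev_ord i) (rev_ord j); rewrite pw0_conjE !rev_ordK; apply => /=.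
  by rewrite ltn_sub2l // (leq_ltn_trans lt).
by rewrite pw0_conjE low //= ltn_sub2l // (leq_ltn_trans lt).
Qed.

Lemma lower_unitri_unit L : lower_unitri L -> L \in unitmx.
Proof.
move=> [L1 Lup]; rewrite unitmxE det_trig; last exact/is_trig_mxP.
by rewrite big1 ?unitr1.
Qed.

Lemma lower_unitri_ant L : lower_unitri L -> flag_act L Fant = Fant.
Proof.
by move=> Ll; apply/flag_act_antP; [apply: lower_unitri_unit | case: Ll].
Qed.

Lemma lower_unitri_antV L : lower_unitri L -> flag_act (invmx L) Fant = Fant.
Proof.
by move=> Ll; rewrite -{1}(lower_unitri_ant Ll) flag_actK ?lower_unitri_unit.
Qed.

Lemma lower_unitri_mul_diag L M i : lower_unitri L ->
  (forall a c : 'I_k, (a < c)%N -> M a c = 0) -> (L *m M) i i = M i i.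
Proof.
move=> [L1 Lup] Mup; rewrite !mxE (bigD1 i) //= L1 mul1r big1 ?addr0 // => j.
rewrite -val_eqE /=; case: (ltngtP j i) => // lt _; first by rewrite Mup ?mulr0.
by rewrite Lup ?mul0r.
Qed.

Lemma lower_unitri_div L L' : lower_unitri L -> lower_unitri L' ->
  lower_unitri (invmx L *m L').
Proof.
move=> Ll L'l; have [Lu L'u] := (lower_unitri_unit Ll, lower_unitri_unit L'l).
have low : forall a c : 'I_k, (a < c)%N -> (invmx L *m L') a c = 0.
  apply/flag_act_antP; first by rewrite unitmx_mul unitmx_inv Lu.
  by rewrite -flag_actM lower_unitri_ant ?lower_unitri_antV.
split=> // i; rewrite -(lower_unitri_mul_diag i Ll low) mulKVmx //.
by case: L'l.
Qed.

(** Two choices of L differ by a matrix that is both lower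
unitriangular and upper triangular, hence trivial. *)
Lemma lower_partE M V L : M \in unitmx -> lower_unitri L ->
  V = flag_of (M *m L) -> lower_part M V = L.
Proof.
move=> Mu Ll ->; apply: xget_unique => // L' [L'l].
have [Lu L'u] := (lower_unitri_unit Ll, lower_unitri_unit L'l).
move=> /(flag_of_eqP _ _).1; rewrite !unitmx_mul Mu => /(_ Lu L'u).
rewrite invmx_mul // -mulmxA mulKmx // => Tup.
have [T1 Tlow] := lower_unitri_div Ll L'l.
have T_eq1 : invmx L *m L' = 1%:M.
  apply/matrixP => i j; rewrite [RHS]mxE -val_eqE /=.
  by case: (ltngtP i j) => [/Tlow//|/Tup//|/val_inj->]; apply: T1.
by rewrite -[LHS](mulKVmx Lu) T_eq1 mulmx1.
Qed.

(** A matrix M with V = F(M) and F(w0) = F(M w0) fixes F(w0), so it is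
lower triangular; dividing its columns by its diagonal entries does not change
F(M) and makes it unitriangular. *)
Lemma transverse_antP V : transverse V Fant <->
  exists2 L, lower_unitri L & V = flag_of L.
Proof.
split=> [/rel_posP[M [Mu -> ant]]|[L Ll ->]]; last first.
  apply/rel_posP; exists L; rewrite lower_unitri_unit // -flag_act_of.
  by split=> //; rewrite -[LHS](lower_unitri_ant Ll).
have Mlow : forall a c : 'I_k, (a < c)%N -> M a c = 0.
  by apply/flag_act_antP => //; rewrite [RHS]ant -flag_act_of.
have Mdiag i : M i i != 0.
  have : \det M != 0 by rewrite -unitfE -unitmxE.
  rewrite det_trig; last exact/is_trig_mxP.
  by move=> /prodf_neq0/(_ i isT).
pose d : 'rV[K]_k := \row_i (M i i)^-1.
have du : diag_mx d \in unitmx.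
  rewrite unitmxE det_diag unitfE; apply/prodf_neq0 => i _.
  by rewrite mxE invr_eq0.
exists (M *m diag_mx d).
  split=> [i|i j lt]; rewrite mul_mx_diag !mxE; first exact: divff.
  by rewrite (Mlow i j) ?mul0r.
apply/flag_of_eqP; rewrite ?unitmx_mul ?Mu // mulKmx // => i j lt.
by rewrite !mxE -val_eqE /= gtn_eqF.
Qed.

(** * The maps from double Bott-Samelson to braid varieties *)

Lemma pw0_flag_ant : flag_act pw0 (Fant : flag K k) = Fstd.
Proof. by rewrite flag_act_of pw0K. Qed.

(** The two conventions for joining chains that share a flag: it is
dropped from the first chain in phi2 and from the second one in phi1. *)
Lemma take_glue A C : A != [::] -> C != [::] -> lastF A = nthF C 0 ->
  take (size A).-1 A ++ C = A ++ behead C.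
Proof.
case: C => // V C; elim/last_ind: A => // A W _ _ _.
rewrite /lastF last_rcons /nthF /= => ->.
by rewrite size_rcons /= -cats1 take_size_cat // -catA.
Qed.

Lemma lastF_glue A C : C != [::] -> lastF A = nthF C 0 ->
  lastF (A ++ behead C) = lastF C.
Proof. by case: C => // V C _; rewrite /lastF last_cat => ->. Qed.

Lemma BS_lowerP b Fs : BS K b Fs <-> [/\ chain b Fs, nthF Fs 0 = Fstd &
  exists2 L, lower_unitri L & lastF Fs = flag_of L].
Proof. by split=> -[chF F0 /transverse_antP lastF_]. Qed.

(** The flag F(L) is joined to F(w0) = F(L w0) by the coordinate chain
moved by L. *)
Lemma phi1E D L Fs : reduced_word D (w0 k) -> lower_unitri L ->
  lastF Fs = flag_of L -> phi1 D Fs = Fs ++ behead (std_chain L D).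
Proof.
move=> rD Ll FL; rewrite /phi1 (the_chainE rD (lower_unitri_unit Ll) FL) //.
by rewrite -flag_act_of; apply/esym/lower_unitri_ant.
Qed.

Lemma flag_act_antV L : lower_unitri L -> flag_of (invmx L *m pw0) = Fant.
Proof. by rewrite -flag_act_of; apply: lower_unitri_antV. Qed.

Lemma flag_of_w0_conj L : lower_unitri L ->
  flag_of (pw0 *m invmx L *m pw0) = Fstd.
Proof.
move=> Ll; rewrite -mulmxA -flag_act_of flag_act_antV //.
exact: pw0_flag_ant.
Qed.

Lemma w0_conj_unit L : lower_unitri L -> pw0 *m invmx L *m pw0 \in unitmx.
Proof.
by move=> Ll; rewrite !unitmx_mul pmat_unit unitmx_inv lower_unitri_unit.
Qed.

(** The conjugate w0 L^-1 w0 is upper triangular, so it fixes F(e), and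
it sends F(w0) to w0 L^-1 F(e): it moves the coordinate chain to the required
one. *)
Lemma phi2E D L Fs : reduced_word D (w0 k) -> lower_unitri L -> Fs != [::] ->
  nthF Fs 0 = Fstd -> lastF Fs = flag_of L ->
  phi2 D Fs = take (size D) (std_chain (pw0 *m invmx L *m pw0) D) ++
    [seq flag_act (pw0 *m invmx L) V | V <- Fs].
Proof.
move=> rD Ll F_neq0 F0 FL; rewrite /phi2.
have -> : lower_part 1%:M (lastF Fs) = L.
  by apply: lower_partE; rewrite ?unitmx1 ?mul1mx.
rewrite (the_chainE rD (w0_conj_unit Ll)) ?flag_of_w0_conj //.
rewrite nthF_act ?lt0n ?size_eq0 // F0 flag_act_of mulmx1.
by rewrite -(mulmxA _ pw0) pw0K mulmx1.
Qed.

Lemma phi1_X b D Fs : reduced_word D (w0 k) ->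
  BS K b Fs -> X K (b ++ D) (phi1 D Fs).
Proof.
move=> rD /BS_lowerP[chF F0 [L Ll FL]]; rewrite (phi1E rD Ll FL).
have Lu := lower_unitri_unit Ll; have chC := chain_std_chain D Lu.
have FC : lastF Fs = nthF (std_chain L D) 0.
  by rewrite nth_std_chain // take0 word_perm_nil pmat1 mulmx1.
split; first exact: chain_cat.
  by case: (Fs) (chain_neq0 chF) F0.
rewrite lastF_glue ?(chain_neq0 chC) // last_std_chain (proj1 rD).
by rewrite -flag_act_of; apply: lower_unitri_ant.
Qed.

Lemma phi2_X b D Fs : reduced_word D (w0 k) ->
  BS K b Fs -> X K (D ++ b) (phi2 D Fs).
Proof.
move=> rD /BS_lowerP[chF F0 [L Ll FL]]; have F_neq0 := chain_neq0 chF.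
rewrite (phi2E rD Ll F_neq0 F0 FL).
have Lu := lower_unitri_unit Ll.
set C := std_chain _ _; set h := pw0 *m invmx L; set Gs := map _ _.
have hu : h \in unitmx by rewrite unitmx_mul pmat_unit unitmx_inv.
have chC : chain D C := chain_std_chain D (w0_conj_unit Ll).
have chG : chain b Gs by apply: chain_act.
have CG : lastF C = nthF Gs 0.
  rewrite last_std_chain (proj1 rD) nthF_act ?lt0n ?size_eq0 // F0 flag_act_of.
  by rewrite mulmx1 -(mulmxA _ pw0) pw0K mulmx1.
have -> : size D = (size C).-1 by rewrite size_std_chain.
rewrite take_glue ?(chain_neq0 chC) ?(chain_neq0 chG) //.
split; first exact: chain_cat.
  by rewrite /nthF /C /= take0 word_perm_nil pmat1 mulmx1 flag_of_w0_conj.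
rewrite lastF_glue ?(chain_neq0 chG) // lastF_act // FL flag_act_of.
by rewrite -mulmxA mulVmx // mulmx1.
Qed.

Lemma map_Ftilde D h : reduced_word D (w0 k) ->
  [seq flag_act h V | V <- [seq Ftilde K D j | j <- iota 0 (ell (w0 k))]] =
  take (size D) (std_chain (h *m pw0) D).
Proof.
case=> _ <-; rewrite -std_chain_act -map_take /std_chain -map_take.
by rewrite take_iota; move/minn_idPl: (leqnSn (size D)) => ->.
Qed.

Lemma map_Ftilde1 D h : reduced_word D (w0 k) ->
  [seq flag_act h V | V <- [seq Ftilde K D j | j <- iota 1 (ell (w0 k))]] =
  behead (std_chain (h *m pw0) D).
Proof. by case=> _ <-; rewrite -std_chain_act. Qed.

(** * Splicing *)

Section Splicing.
Variables (D b1 b2 : seq 'I_k.-1) (Fs : seq (flag K k)) (L1 L : 'M[K]_k).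
Hypotheses (rD : reduced_word D (w0 k)) (chF : chain (b1 ++ b2) Fs).
Hypotheses (F0 : nthF Fs 0 = Fstd).
Hypotheses (L1l : lower_unitri L1) (Ll : lower_unitri L).
Hypotheses (FL1 : nthF Fs (size b1) = flag_of L1) (FL : lastF Fs = flag_of L).
Let r1 := size b1.
Let L1u := lower_unitri_unit L1l.
Let Lu := lower_unitri_unit Ll.
Let L12l := lower_unitri_div L1l Ll.

Let szF : (r1 < size Fs)%N.
Proof. by have [-> _ _] := chF; rewrite size_cat ltnS leq_addr. Qed.

Let take_neq0 : take r1.+1 Fs != [::].
Proof. by rewrite -size_eq0 size_takel. Qed.

Let drop_neq0 : drop r1 Fs != [::].
Proof. by rewrite -size_eq0 size_drop subn_eq0 -ltnNge. Qed.

Let take_F0 : nthF (take r1.+1 Fs) 0 = Fstd.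
Proof. by rewrite /nthF nth_take. Qed.

Let take_FL : lastF (take r1.+1 Fs) = flag_of L1.
Proof. by rewrite /lastF -nth_last size_takel // nth_take. Qed.

Let drop_F0 : nthF [seq flag_act (invmx L1) V | V <- drop r1 Fs] 0 = Fstd.
Proof.
rewrite nthF_act ?lt0n ?size_eq0 // /nthF nth_drop addn0.
by rewrite -[nth _ _ _]/(nthF _ _) FL1 flag_act_of mulVmx.
Qed.

Let drop_FL : lastF [seq flag_act (invmx L1) V | V <- drop r1 Fs] =
  flag_of (invmx L1 *m L).
Proof.
rewrite lastF_act // -flag_act_of -FL; congr flag_act.
by rewrite /lastF -!nth_last nth_drop size_drop; congr nth; lia.
Qed.

Lemma Phi_BS_E : Phi_BS r1 Fs =
  (take r1.+1 Fs, [seq flag_act (invmx L1) V | V <- drop r1 Fs]).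
Proof. by rewrite /Phi_BS (lower_partE (unitmx1 _ _) L1l) // mul1mx. Qed.

(** Left multiplication by L1^-1 preserves transversality to F(w0), and
L1^-1 L is the unitriangular matrix of the last flag of the second half. *)
Lemma Phi_BS_BS : BS K b1 (Phi_BS r1 Fs).1 /\ BS K b2 (Phi_BS r1 Fs).2.
Proof.
rewrite Phi_BS_E /=; split; apply/BS_lowerP; split=> //.
- exact: chain_takel chF.
- by exists L1.
- by apply: chain_act; rewrite ?unitmx_inv //; apply: chain_drop chF.
by exists (invmx L1 *m L).
Qed.

(** The common value of both sides in the two diagrams. *)
Lemma phi_Phi_BS_E :
  (phi2 D (Phi_BS r1 Fs).1, phi1 D (Phi_BS r1 Fs).2) =
  (take (size D) (std_chain (pw0 *m invmx L1 *m pw0) D) ++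
     [seq flag_act (pw0 *m invmx L1) V | V <- take r1.+1 Fs],
   [seq flag_act (invmx L1) V | V <- drop r1 Fs] ++
     behead (std_chain (invmx L1 *m L) D)).
Proof.
rewrite Phi_BS_E /= (phi2E rD L1l take_neq0 take_F0 take_FL).
by rewrite (phi1E rD L12l drop_FL).
Qed.

Let BSF : BS K (b1 ++ b2) Fs.
Proof. by apply/BS_lowerP; split=> //; exists L. Qed.

Lemma phi1_splice :
  U_X K ((b1 ++ b2) ++ D) r1 1%g (phi1 D Fs) /\
  Phi_X D r1 1%g (phi1 D Fs) =
    (phi2 D (Phi_BS r1 Fs).1, phi1 D (Phi_BS r1 Fs).2).
Proof.
have nthr1 : nthF (phi1 D Fs) r1 = flag_of L1.
  by rewrite (phi1E rD Ll FL) /nthF nth_cat szF -[nth _ _ _]/(nthF _ _).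
split.
  split; first exact: phi1_X.
  by rewrite pmat1 mulmx1; apply/transverse_antP; exists L1.
rewrite phi_Phi_BS_E /Phi_X ell1 subn0 cats0 pmat1 mulmx1 pw0K.
rewrite (lower_partE (unitmx1 _ _) L1l) ?mul1mx // (phi1E rD Ll FL).
rewrite map_cat map_Ftilde // takel_cat // drop_cat szF map_cat.
by rewrite -behead_map std_chain_act.
Qed.

Lemma phi2_splice :
  U_X K (D ++ (b1 ++ b2)) (r1 + ell (w0 k))%N (w0 k) (phi2 D Fs) /\
  Phi_X D (r1 + ell (w0 k))%N (w0 k) (phi2 D Fs) =
    (phi2 D (Phi_BS r1 Fs).1, phi1 D (Phi_BS r1 Fs).2).
Proof.
have F_neq0 := chain_neq0 chF.
have phi2F := phi2E rD Ll F_neq0 F0 FL.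
pose h := pw0 *m invmx L.
have hu : h \in unitmx by rewrite unitmx_mul pmat_unit unitmx_inv.
have sz_take g : size (take (size D) (std_chain g D)) = ell (w0 k).
  by rewrite size_takel ?size_std_chain // (proj2 rD).
have nthr1 : nthF (phi2 D Fs) (r1 + ell (w0 k)) = flag_of (h *m L1).
  rewrite phi2F /nthF nth_cat sz_take ltnNge leq_addl addnK /=.
  by rewrite (nth_map Fstd) // -[nth _ _ _]/(nthF Fs r1) FL1 flag_act_of.
split.
  split; first exact: phi2_X.
  rewrite nthr1 pw0K -flag_act_of.
  have -> : flag_of 1%:M = flag_act h Fant.
    by rewrite -flag_actM lower_unitri_antV // pw0_flag_ant.
  by apply: rel_pos_act => //; apply/transverse_antP; exists L1.
rewrite phi_Phi_BS_E /Phi_X subnn pw0K mul1mx nthr1.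
rewrite (lower_partE (pmat_unit _) (lower_unitri_div Ll L1l)) ?mulmxA //.
have -> : invmx (pw0 *m invmx L *m L1) = invmx L1 *m L *m pw0.
  rewrite !invmx_mul ?unitmx_inv ?pmat_unit // invmxK invmx_pmat mulmxA.
  by rewrite (_ : (w0 k)^-1 = w0 k)%g //; apply/eqP; rewrite eq_invg_mul w0K.
(* The matrix g2 undoes the translation made by phi2 and then acts as L1^-1. *)
have g2h : invmx L1 *m L *m pw0 *m (pw0 *m invmx L) = invmx L1.
  rewrite !mulmxA -(mulmxA _ pw0 pw0) pw0K mulmx1.
  by rewrite -(mulmxA _ L) mulmxV // mulmx1.
rewrite phi2F take_cat sz_take ltnNge -addSn leq_addl addnK /=.
rewrite drop_cat sz_take (ltnNge (_ + _)%N) leq_addl addnK /=.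
rewrite !map_cat map_Ftilde1 // -(mulmxA _ pw0 pw0) pw0K mulmx1.
rewrite map_take std_chain_act.
rewrite -map_take -map_drop -!map_comp.
congr (_ ++ _, _ ++ _).
- congr (take _ (std_chain _ _)).
  by rewrite -(mulmxA pw0) [in LHS](mulmxA (_ *m _ *m pw0)) g2h mulmxA.
- by apply: eq_map => V /=; rewrite flag_actM -mulmxA g2h.
- by apply: eq_map => V /=; rewrite flag_actM g2h.
Qed.
End Splicing.
End BraidVarieties.

Theorem theorem1p8 (K : fieldType) (k : nat) (D b1 b2 : seq 'I_k.-1)
    (hD : reduced_word D (w0 k)) :
  let b := b1 ++ b2 in
  let r1 := size b1 in
  let U := U_BS K b r1 in
  let Phi : seq (flag K k) -> seq (flag K k) * seq (flag K k) := Phi_BS r1 in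
  let phi2xphi1 : seq (flag K k) * seq (flag K k) ->
                  seq (flag K k) * seq (flag K k) :=
    fun p => (phi2 D p.1, phi1 D p.2) in
  [/\ forall Fs, U Fs -> (BS K b1 `*` BS K b2) (Phi Fs),
      forall Fs, U Fs ->
        (X K (D ++ b1) `*` X K (b2 ++ D)) (phi2xphi1 (Phi Fs)),
      forall Fs, U Fs ->
        U_X K (b ++ D) r1 1%g (phi1 D Fs) /\
        Phi_X D r1 1%g (phi1 D Fs) = phi2xphi1 (Phi Fs) &
      forall Fs, U Fs ->
        U_X K (D ++ b) (r1 + ell (w0 k)) (w0 k) (phi2 D Fs) /\
        Phi_X D (r1 + ell (w0 k)) (w0 k) (phi2 D Fs) = phi2xphi1 (Phi Fs)].
Proof.
move=> b r1 U Phi phi2xphi1.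
have UP Fs : U Fs -> exists L1 L, [/\ chain b Fs, nthF Fs 0 = Fstd,
    lower_unitri L1 /\ lower_unitri L, nthF Fs r1 = flag_of L1
    & lastF Fs = flag_of L].
  move=> [/BS_lowerP[chF F0 [L Ll FL]] /transverse_antP[L1 L1l FL1]].
  by exists L1, L.
split=> Fs /UP[L1 [L [chF F0 [L1l Ll] FL1 FL]]].
- exact: Phi_BS_BS FL1 FL.
- have [BS1 BS2] := Phi_BS_BS chF F0 L1l Ll FL1 FL.
  by split; [apply: phi2_X | apply: phi1_X].
- exact: phi1_splice FL1 FL.
- exact: phi2_splice FL1 FL.
Qed.
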